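(* The Galilean group $G(2)$ is isomorphic to the group $\Lambda^1(\mathbf{R}^2)$ (under multiplication) of all elements of the Grassmann algebra $\Lambda(\mathbf{R}^2)$ with unit scalar part: $$G(2)\cong\Lambda^1(\mathbf{R}^2).$$
   Context: The Galilean group $G(2)$ (the group of motions of the Galilean plane) is the group, under composition, of all transformations of $\mathbf{R}^2$ of the form $(x,y)\mapsto(x+a,\;y+\theta x+b)$ with $a,b,\theta\in\mathbf{R}$ (compositions of translations along the coordinate axes and Galilean rotations/boosts). Equivalently, it is the group of real matrices $\begin{pmatrix} 1 & 0 & 0 \\ a & 1 & 0 \\ b & \theta & 1 \end{pmatrix}$ under multiplication. The Grassmann algebra $\Lambda(\mathbf{R}^2)$ is the associative real unital algebra with two generators $e_1,e_2$ satisfying $e_1^2=e_2^2=0$, $e_1e_2=-e_2e_1$; its general element is uniquely $q=\alpha_0+\alpha_1e_1+\alpha_2e_2+\alpha_3e_1e_2$ with $\alpha_i\in\mathbf{R}$, and $\alpha_0$ is its scalar part. The conjugate is $\bar q=\alpha_0-\alpha_1e_1-\alpha_2e_2-\alpha_3e_1e_2$ and the norm is given by $|q|^2=q\bar q=\alpha_0^2$. $\Lambda^1(\mathbf{R}^2)$ is the set of elements of unit norm with $\alpha_0=1$, i.e. the set of all elements $1+\alpha_1e_1+\alpha_2e_2+\alpha_3e_1e_2$ with $\alpha_i\in\mathbf{R}$; it is a group under multiplication. *)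

(* Defs.v *)
From HB Require Import structures.
From mathcomp Require Import all_boot all_order all_algebra.
From mathcomp Require Import ring.
From mathcomp Require Import boolp reals.

Set Implicit Arguments.
Unset Strict Implicit.
Unset Printing Implicit Defensive.

Import GRing.Theory.
Local Open Scope ring_scope.

Section Galilean.
Variable R : comNzRingType.

Definition galilean_motion (a b theta : R) (p : R * R) : R * R :=
  (p.1 + a, p.2 + theta * p.1 + b).

Definition is_galilean (g : R * R -> R * R) : Prop :=
  exists a b theta : R, g = galilean_motion a b theta.

(* [`[< _ >]] turns the proposition into a boolean, so that two motions are equal
   as soon as their underlying maps are. *)
Record galilean_group := GalileanGroup {
  galilean_fun :> R * R -> R * R;
  _ : `[< is_galilean galilean_fun >] }.

HB.instance Definition _ := [isSub for galilean_fun].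
HB.instance Definition _ := [Choice of galilean_group by <:].

Lemma galilean_groupP (g : galilean_group) : is_galilean g.
Proof. by case: g => g /= /asboolP. Qed.

Fact galilean_one_subproof : `[< is_galilean id >].
Proof.
apply/asboolP; exists 0, 0, 0; apply/funext => -[x y].
by rewrite /galilean_motion /= mul0r !addr0.
Qed.

Definition galilean_one := GalileanGroup galilean_one_subproof.

Fact galilean_mul_subproof (g h : galilean_group) :
  `[< is_galilean (g \o h) >].
Proof.
have [[a [b [t eg]]] [c [d [s eh]]]] := (galilean_groupP g, galilean_groupP h).
apply/asboolP; exists (a + c), (b + d + t * c), (t + s).
apply/funext => -[x y]; rewrite eg eh /galilean_motion /=.
by congr pair; ring.
Qed.

(* The product is composition, [g] after [h]. *)
Definition galilean_mul g h := GalileanGroup (galilean_mul_subproof g h).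

(* The parameters of [g] are read off from the images of (0, 0) and (1, 0). *)
Definition galilean_inv_fun (g : galilean_group) : R * R -> R * R :=
  let a := (g (0, 0)).1 in
  let b := (g (0, 0)).2 in
  let theta := (g (1, 0)).2 - b in
  galilean_motion (- a) (theta * a - b) (- theta).

Fact galilean_inv_subproof (g : galilean_group) :
  `[< is_galilean (galilean_inv_fun g) >].
Proof. by apply/asboolP; eexists _, _, _. Qed.

Definition galilean_inv g := GalileanGroup (galilean_inv_subproof g).

Fact galilean_mulA : associative galilean_mul.
Proof. by move=> g h k; apply: val_inj. Qed.

Fact galilean_mul1 : left_id galilean_one galilean_mul.
Proof. by move=> g; apply: val_inj. Qed.

Fact galilean_mulr1 : right_id galilean_one galilean_mul.
Proof. by move=> g; apply: val_inj. Qed.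

Fact galilean_mulV : left_inverse galilean_one galilean_inv galilean_mul.
Proof.
move=> g; apply: val_inj; apply/funext => -[x y] /=.
have [a [b [t eg]]] := galilean_groupP g.
by rewrite /galilean_inv_fun eg /galilean_motion /=; congr pair; ring.
Qed.

Fact galilean_mulrV : right_inverse galilean_one galilean_inv galilean_mul.
Proof.
move=> g; apply: val_inj; apply/funext => -[x y] /=.
have [a [b [t eg]]] := galilean_groupP g.
by rewrite /galilean_inv_fun eg /galilean_motion /=; congr pair; ring.
Qed.

HB.instance Definition _ := isGroup.Build galilean_group
  galilean_mulA galilean_mul1 galilean_mulr1 galilean_mulV galilean_mulrV.

End Galilean.

(* [Grassmann a0 a1 a2 a3] stands for a0 + a1 e1 + a2 e2 + a3 e1 e2, and [gr0]
   is the scalar part.  The lemmas [grassmann_relations], [grassmannE] and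
   [grassmann_basis_inj] check that [gr_e1] and [gr_e2] satisfy the defining
   relations and that this expansion exists and is unique. *)
Record grassmann (R : Type) := Grassmann {
  gr0 : R; gr1 : R; gr2 : R; gr3 : R }.

Section GrassmannEncoding.
Variable R : Type.

Definition grassmann_tuple (p : grassmann R) : R * R * R * R :=
  (gr0 p, gr1 p, gr2 p, gr3 p).

Definition tuple_grassmann (t : R * R * R * R) : grassmann R :=
  Grassmann t.1.1.1 t.1.1.2 t.1.2 t.2.

Lemma grassmann_tupleK : cancel grassmann_tuple tuple_grassmann.
Proof. by case. Qed.

End GrassmannEncoding.

HB.instance Definition _ (R : choiceType) :=
  Choice.copy (grassmann R) (can_type (@grassmann_tupleK R)).

Section Grassmann.
Variable R : comNzRingType.
Implicit Types p q r : grassmann R.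

Definition grassmann_zero : grassmann R := Grassmann 0 0 0 0.

Definition grassmann_opp p : grassmann R :=
  Grassmann (- gr0 p) (- gr1 p) (- gr2 p) (- gr3 p).

Definition grassmann_add p q : grassmann R :=
  Grassmann (gr0 p + gr0 q) (gr1 p + gr1 q) (gr2 p + gr2 q) (gr3 p + gr3 q).

Fact grassmann_addA : associative grassmann_add.
Proof. by move=> [????] [????] [????]; congr Grassmann; apply: addrA. Qed.

Fact grassmann_addC : commutative grassmann_add.
Proof. by move=> [????] [????]; congr Grassmann; apply: addrC. Qed.

Fact grassmann_add0 : left_id grassmann_zero grassmann_add.
Proof. by move=> [????]; congr Grassmann; apply: add0r. Qed.

Fact grassmann_addN : left_inverse grassmann_zero grassmann_opp grassmann_add.
Proof. by move=> [????]; congr Grassmann; apply: addNr. Qed.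

HB.instance Definition _ := GRing.isZmodule.Build (grassmann R)
  grassmann_addA grassmann_addC grassmann_add0 grassmann_addN.

Definition grassmann_one : grassmann R := Grassmann 1 0 0 0.

Definition grassmann_mul p q : grassmann R :=
  Grassmann (gr0 p * gr0 q)
            (gr0 p * gr1 q + gr1 p * gr0 q)
            (gr0 p * gr2 q + gr2 p * gr0 q)
            (gr0 p * gr3 q + gr3 p * gr0 q + gr1 p * gr2 q - gr2 p * gr1 q).

Fact grassmann_mulA : associative grassmann_mul.
Proof. by move=> [????] [????] [????]; congr Grassmann => /=; ring. Qed.

Fact grassmann_mul1 : left_id grassmann_one grassmann_mul.
Proof. by move=> [????]; congr Grassmann => /=; ring. Qed.

Fact grassmann_mulr1 : right_id grassmann_one grassmann_mul.
Proof. by move=> [????]; congr Grassmann => /=; ring. Qed.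

Fact grassmann_mulDl : left_distributive grassmann_mul +%R.
Proof. by move=> [????] [????] [????]; congr Grassmann => /=; ring. Qed.

Fact grassmann_mulDr : right_distributive grassmann_mul +%R.
Proof. by move=> [????] [????] [????]; congr Grassmann => /=; ring. Qed.

Fact grassmann_one_neq0 : grassmann_one != 0.
Proof. by apply/eqP => -[] /eqP; rewrite oner_eq0. Qed.

HB.instance Definition _ := GRing.Zmodule_isNzRing.Build (grassmann R)
  grassmann_mulA grassmann_mul1 grassmann_mulr1 grassmann_mulDl grassmann_mulDr
  grassmann_one_neq0.

Definition grassmann_scale (c : R) p : grassmann R :=
  Grassmann (c * gr0 p) (c * gr1 p) (c * gr2 p) (c * gr3 p).

Fact grassmann_scaleA c d p :
  grassmann_scale c (grassmann_scale d p) = grassmann_scale (c * d) p.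
Proof. by case: p => *; congr Grassmann; apply: mulrA. Qed.

Fact grassmann_scale1 : left_id 1 grassmann_scale.
Proof. by move=> [????]; congr Grassmann; apply: mul1r. Qed.

Fact grassmann_scaleDr : right_distributive grassmann_scale +%R.
Proof. by move=> c [????] [????]; congr Grassmann; apply: mulrDr. Qed.

Fact grassmann_scaleDl p : {morph grassmann_scale^~ p : c d / c + d}.
Proof. by case: p => * c d; congr Grassmann; apply: mulrDl. Qed.

HB.instance Definition _ := GRing.Zmodule_isLmodule.Build R (grassmann R)
  grassmann_scaleA grassmann_scale1 grassmann_scaleDr grassmann_scaleDl.

Fact grassmann_scaleAl (c : R) p q : c *: (p * q) = (c *: p) * q.
Proof. by case: p q => [????] [????]; congr Grassmann => /=; ring. Qed.

HB.instance Definition _ := GRing.Lmodule_isLalgebra.Build R (grassmann R)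
  grassmann_scaleAl.

Fact grassmann_scaleAr (c : R) p q : c *: (p * q) = p * (c *: q).
Proof. by case: p q => [????] [????]; congr Grassmann => /=; ring. Qed.

HB.instance Definition _ := GRing.Lalgebra_isAlgebra.Build R (grassmann R)
  grassmann_scaleAr.

Definition gr_e1 : grassmann R := Grassmann 0 1 0 0.
Definition gr_e2 : grassmann R := Grassmann 0 0 1 0.

Lemma grassmann_relations :
  [/\ gr_e1 * gr_e1 = 0, gr_e2 * gr_e2 = 0 & gr_e1 * gr_e2 = - (gr_e2 * gr_e1)].
Proof. by split; congr Grassmann => /=; ring. Qed.

Definition grassmann_comb (a0 a1 a2 a3 : R) : grassmann R :=
  a0%:A + a1 *: gr_e1 + a2 *: gr_e2 + a3 *: (gr_e1 * gr_e2).

Lemma grassmann_combE a0 a1 a2 a3 :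
  grassmann_comb a0 a1 a2 a3 = Grassmann a0 a1 a2 a3.
Proof. by congr Grassmann => /=; ring. Qed.

Lemma grassmannE q : q = grassmann_comb (gr0 q) (gr1 q) (gr2 q) (gr3 q).
Proof. by rewrite grassmann_combE; case: q. Qed.

Lemma grassmann_basis_inj a0 a1 a2 a3 b0 b1 b2 b3 :
  grassmann_comb a0 a1 a2 a3 = grassmann_comb b0 b1 b2 b3 ->
  [/\ a0 = b0, a1 = b1, a2 = b2 & a3 = b3].
Proof. by rewrite !grassmann_combE => -[]. Qed.

Definition grassmann_conj q : grassmann R :=
  Grassmann (gr0 q) (- gr1 q) (- gr2 q) (- gr3 q).

Lemma grassmann_conjP q : q * grassmann_conj q = (gr0 q ^+ 2)%:A.
Proof. by case: q => *; congr Grassmann => /=; ring. Qed.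

Lemma grassmann_conjPl q : grassmann_conj q * q = (gr0 q ^+ 2)%:A.
Proof. by case: q => *; congr Grassmann => /=; ring. Qed.

End Grassmann.

Section UnitScalarPart.
Variable R : comNzRingType.

(* Lambda^1: the squared norm q * conj q is gr0 q ^ 2 ([grassmann_conjP]), so
   these elements have unit norm and conjugation is the group inverse. *)
Record grassmann_unit_scalar := GrassmannUnitScalar {
  grassmann_of_unit_scalar :> grassmann R;
  _ : gr0 grassmann_of_unit_scalar == 1 }.

HB.instance Definition _ := [isSub for grassmann_of_unit_scalar].
HB.instance Definition _ := [Choice of grassmann_unit_scalar by <:].

Implicit Types p q r : grassmann_unit_scalar.

Lemma grassmann_unit_scalarP q : gr0 q = 1.
Proof. by case: q => q /= /eqP. Qed.

Definition unit_scalar_one := @GrassmannUnitScalar 1 (eqxx 1).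

Fact unit_scalar_mul_subproof p q :
  gr0 ((p : grassmann R) * (q : grassmann R)) == 1.
Proof. by rewrite /= !grassmann_unit_scalarP mulr1. Qed.

Definition unit_scalar_mul p q :=
  GrassmannUnitScalar (unit_scalar_mul_subproof p q).

Fact unit_scalar_inv_subproof q : gr0 (grassmann_conj q) == 1.
Proof. by rewrite /= grassmann_unit_scalarP. Qed.

Definition unit_scalar_inv q := GrassmannUnitScalar (unit_scalar_inv_subproof q).

Fact unit_scalar_mulA : associative unit_scalar_mul.
Proof. by move=> p q r; apply: val_inj; apply: mulrA. Qed.

Fact unit_scalar_mul1 : left_id unit_scalar_one unit_scalar_mul.
Proof. by move=> q; apply: val_inj; apply: mul1r. Qed.

Fact unit_scalar_mulr1 : right_id unit_scalar_one unit_scalar_mul.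
Proof. by move=> q; apply: val_inj; apply: mulr1. Qed.

Fact unit_scalar_mulV :
  left_inverse unit_scalar_one unit_scalar_inv unit_scalar_mul.
Proof.
move=> q; apply: val_inj; rewrite /= grassmann_conjPl grassmann_unit_scalarP.
by rewrite expr1n scale1r.
Qed.

Fact unit_scalar_mulrV :
  right_inverse unit_scalar_one unit_scalar_inv unit_scalar_mul.
Proof.
move=> q; apply: val_inj; rewrite /= grassmann_conjP grassmann_unit_scalarP.
by rewrite expr1n scale1r.
Qed.

HB.instance Definition _ := isGroup.Build grassmann_unit_scalar
  unit_scalar_mulA unit_scalar_mul1 unit_scalar_mulr1
  unit_scalar_mulV unit_scalar_mulrV.

End UnitScalarPart.

(* Main.v *)
(** The motion with parameters (a, b, theta) is sent to
    1 + theta e1 + a e2 + (2 b - theta a) e1 e2.  The composition law adds theta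
    and a and contributes the cocycle theta a' to b + b'; replacing b by
    2 b - theta a antisymmetrizes it into theta a' - a theta', which is the
    e1 e2 coefficient of the product of two elements of Lambda^1. *)

From HB Require Import structures.
Require Import Defs.
From mathcomp Require Import all_boot all_order all_algebra.
From mathcomp Require Import ring.
From mathcomp Require Import boolp reals.

Import GRing.Theory Num.Theory.
Local Open Scope ring_scope.

Section GalileanToGrassmann.
Variable R : comNzRingType.

(** A motion with parameters (a, b, theta) sends (0, 0) to (a, b) and (1, 0) to (1 + a, theta +
    b). *)
Definition galilean_a (g : galilean_group R) : R := (g (0, 0)).1.
Definition galilean_b (g : galilean_group R) : R := (g (0, 0)).2.
Definition galilean_theta (g : galilean_group R) : R :=
  (g (1, 0)).2 - (g (0, 0)).2.

Lemma galilean_params (g : galilean_group R) (a b theta : R) :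
    g = galilean_motion a b theta :> (R * R -> R * R) ->
  [/\ galilean_a g = a, galilean_b g = b & galilean_theta g = theta].
Proof.
rewrite /galilean_a /galilean_b /galilean_theta => ->.
by rewrite /galilean_motion /=; split; ring.
Qed.

Lemma galileanE (g : galilean_group R) :
  g = galilean_motion (galilean_a g) (galilean_b g) (galilean_theta g)
    :> (R * R -> R * R).
Proof.
have [a [b [t eg]]] := galilean_groupP g.
by have [-> -> ->] := galilean_params _ _ _ _ eg.
Qed.

(** The cross term arises because [g] shears the abscissa already translated by [h]. *)
Lemma galilean_mul_params (g h : galilean_group R) :
  [/\ galilean_a (g * h)%g = galilean_a g + galilean_a h,
      galilean_b (g * h)%g =
        galilean_b g + galilean_b h + galilean_theta g * galilean_a h &
      galilean_theta (g * h)%g = galilean_theta g + galilean_theta h].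
Proof.
(* Parameters are unique, so it suffices that the composite is the motion with these parameters. *)
apply: galilean_params; apply/funext => -[x y] /=.
rewrite (galileanE g) (galileanE h) /galilean_motion /=.
by congr pair; ring.
Qed.

Fact galilean_of_params_subproof (a b theta : R) :
  `[< is_galilean (galilean_motion a b theta) >].
Proof. by apply/asboolP; exists a, b, theta. Qed.

Definition galilean_of_params (a b theta : R) : galilean_group R :=
  GalileanGroup (galilean_of_params_subproof a b theta).

Definition galilean_to_grassmann (g : galilean_group R) :
    grassmann_unit_scalar R :=
  @GrassmannUnitScalar R
    (Grassmann 1 (galilean_theta g) (galilean_a g)
       (2 * galilean_b g - galilean_theta g * galilean_a g))
    (eqxx 1).

Fact galilean_to_grassmannM :
  {morph galilean_to_grassmann : g h / (g * h)%g}.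
Proof.
move=> g h; apply: val_inj => /=.
have [-> -> ->] := galilean_mul_params g h.
by congr Grassmann => /=; ring.
Qed.

HB.instance Definition _ := isMultiplicative.Build _ _
  galilean_to_grassmann galilean_to_grassmannM.

End GalileanToGrassmann.

(** Recovering b from 2 b - theta a takes a division by 2. In characteristic 2 no isomorphism
    exists: the target is then commutative, while composition of motions is not. *)
Lemma galilean_to_grassmann_bij (F : fieldType) :
  (2 : F) != 0 -> bijective (galilean_to_grassmann F).
Proof.
(* With theta = [gr1 q] and a = [gr2 q], the middle argument solves 2 b - theta a = [gr3 q] for
   b. *)
move=> nz2; pose inv (q : grassmann_unit_scalar F) :=
  galilean_of_params F (gr2 q) ((gr3 q + gr1 q * gr2 q) / 2) (gr1 q).
exists inv => [g | q]; apply: val_inj => /=.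
  by rewrite [RHS]galileanE; congr galilean_motion; field.
(* The map underlying [inv q] is a [galilean_motion] by computation, so unification supplies its
   parameters. *)
have [-> -> ->] := galilean_params F (inv q) _ _ _ erefl.
case: q {inv} => -[q0 q1 q2 q3] /= /eqP ->.
by congr Grassmann; field.
Qed.

Theorem proposition4 (R : realType) :
  exists f : {multiplicative galilean_group R -> grassmann_unit_scalar R},
    bijective f.
Proof.
by exists (galilean_to_grassmann R); apply: galilean_to_grassmann_bij;
  rewrite pnatr_eq0.
Qed.
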